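(* Let $G$ be an undirected graph and let $G^*$ be its suspension graph. The ML degree of the Gaussian graphical model with underlying graph $G$ equals the ML degree of the Gaussian graphical model with underlying graph $G^*$.
   Context: For a finite undirected graph $G=(V,E)$, its suspension graph $G^*=(V^*,E^* )$ has an additional vertex $0$ connected to all others: $V^*=V\cup\{0\}$ and $E^*=E\cup\{(0,v):v\in V\}$. By convention the edge set of every graph is taken to contain all self-loops. The Gaussian graphical model of a graph $G=(V,E)$ with $|V|=m$ consists of multivariate normal distributions on $\mathbb{R}^m$ whose concentration matrix $K=\Sigma^{-1}$ satisfies $K_{ij}=0$ for all $(i,j)\notin E$. Its ML degree is, for a generic symmetric matrix $S\in\mathbb{S}^m$, the number of complex invertible symmetric $m\times m$-matrices $\Sigma$ such that $\Sigma_{ij}=S_{ij}$ for all $(i,j)\in E$ and $(\Sigma^{-1})_{ij}=0$ for all $(i,j)\notin E$. *)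

(* Defs.v *)
From HB Require Import structures.
From mathcomp Require Import all_boot all_order all_algebra.
From mathcomp Require Import classical_sets functions cardinality reals.
From mathcomp Require Import complex.
(* Required without Import: its notations clash with those of [reals]. *)
From mathcomp Require mpoly.
Set Implicit Arguments.
Unset Strict Implicit.
Unset Printing Implicit Defensive.

Import Order.TTheory GRing.Theory Num.Theory.
Local Open Scope classical_set_scope.
Local Open Scope ring_scope.
Local Open Scope complex_scope.

(* The vertices of a graph on m vertices are the row indices 'I_m of its
   covariance matrices. The edge relation contains all self-loops. *)
Record graph (m : nat) := Graph {
  edge :> rel 'I_m;
  edge_sym : symmetric edge;
  edge_refl : reflexive edge }.

(* The new vertex is [ord0]; a vertex i of G becomes [lift ord0 i]. *)
Definition suspension_edge m (G : graph m) : rel 'I_m.+1 := fun i j =>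
  match unlift ord0 i, unlift ord0 j with
  | Some i', Some j' => G i' j'
  | _, _ => true
  end.

Lemma suspension_edge_sym m (G : graph m) : symmetric (suspension_edge G).
Proof.
move=> i j; rewrite /suspension_edge.
by case: (unlift _ i) => [i'|]; case: (unlift _ j) => [j'|] //; exact: edge_sym.
Qed.

Lemma suspension_edge_refl m (G : graph m) : reflexive (suspension_edge G).
Proof.
move=> i; rewrite /suspension_edge.
by case: (unlift _ i) => [i'|] //; exact: edge_refl.
Qed.

Definition suspension m (G : graph m) : graph m.+1 :=
  Graph (suspension_edge_sym G) (suspension_edge_refl G).

Definition symmetric_mx (F : Type) m (A : 'M[F]_m) : Prop := A^T = A.

Definition ML_solutions (R : realType) m (G : graph m) (S : 'M[R]_m) :
    set 'M[R[i]]_m :=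
  [set Sigma | [/\ symmetric_mx Sigma,
    Sigma \in unitmx,
    forall i j, G i j -> Sigma i j = (S i j)%:C &
    forall i j, ~~ G i j -> invmx Sigma i j = 0]].

Definition mx_eval (R : realType) m (p : mpoly.mpoly (m * m) R)
    (S : 'M[R]_m) : R :=
  mpoly.meval (fun k => mxvec S 0 k) p.

(* P holds off a proper Zariski closed subset of the space of symmetric
   matrices; the first conjunct says that p does not vanish identically on
   that space, which is stronger than p != 0 (consider x_01 - x_10). *)
Definition generic_symmetric (R : realType) m (P : 'M[R]_m -> Prop) : Prop :=
  exists p : mpoly.mpoly (m * m) R,
    (exists2 S, symmetric_mx S & mx_eval p S != 0) /\
    (forall S, symmetric_mx S -> mx_eval p S != 0 -> P S).

Definition is_ML_degree (R : realType) m (G : graph m) (d : nat) : Prop :=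
  generic_symmetric (fun S : 'M[R]_m => (ML_solutions G S #= `I_d)%card).

Lemma mx_eval_line (R : realType) m (p : mpoly.mpoly (m * m) R)
    (S T : 'M[R]_m) :
  exists q : {poly R}, forall t, q.[t] = mx_eval p (S + t *: (T - S)).
Proof.
pose v k := (mxvec S 0 k)%:P + (mxvec (T - S) 0 k) *: 'X : {poly R}.
exists (mpoly.mmap polyC v p) => t.
rewrite /mx_eval /mpoly.meval /mpoly.mmap horner_sum; apply: eq_bigr => mm _.
rewrite hornerM hornerC; congr (_ * _).
rewrite /mpoly.mmap1 horner_prod; apply: eq_bigr => k _.
rewrite horner_exp /v hornerD hornerC hornerZ hornerX; congr (_ ^+ _).
have -> : mxvec (S + t *: (T - S)) = mxvec S + t *: mxvec (T - S).
  by rewrite linearD; congr (_ + _); rewrite linearZ.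
by rewrite mxE; congr (_ + _); rewrite mxE mulrC.
Qed.

Lemma generic_symmetric_and (R : realType) m (P Q : 'M[R]_m -> Prop) :
  generic_symmetric P -> generic_symmetric Q ->
  exists2 S, symmetric_mx S & P S /\ Q S.
Proof.
move=> [p [[S symS pS] hP]] [q [[T symT qT] hQ]].
have [f fE] := mx_eval_line p S T; have [g gE] := mx_eval_line q S T.
have f0 : f != 0.
  by apply: contraNneq pS => f0; rewrite -[S]addr0 -(scale0r (T - S)) -fE f0 horner0.
have g0 : g != 0.
  apply: contraNneq qT => g0; have := gE 1.
  by rewrite scale1r addrC subrK g0 horner0 => <-.
have fg0 : f * g != 0 by rewrite mulf_neq0.
have [t] : exists t, (f * g).[t] != 0.
  pose s := [seq i%:R : R | i <- iota 0 (size (f * g))].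
  have us : uniq s by rewrite map_inj_uniq ?iota_uniq // => a b /eqP; rewrite eqr_nat => /eqP.
  have /allPn[t _ nt] : ~~ all (root (f * g)) s.
    by apply/negP => /(max_poly_roots fg0)/(_ us); rewrite size_map size_iota ltnn.
  by exists t.
rewrite hornerM mulf_eq0 negb_or fE gE => /andP[ft gt].
have symU : symmetric_mx (S + t *: (T - S)).
  by rewrite /symmetric_mx linearD linearZ linearB /= symS symT.
by exists (S + t *: (T - S)) => //; split; [exact: hP | exact: hQ].
Qed.

(* This makes "the ML degree" of G meaningful. *)
Lemma is_ML_degree_uniq (R : realType) m (G : graph m) d e :
  is_ML_degree R G d -> is_ML_degree R G e -> d = e.
Proof.
move=> hd he; have [S _ [hSd hSe]] := generic_symmetric_and hd he.
by apply/card_eq_II; apply: card_eq_trans hSe; rewrite card_eq_sym.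
Qed.

(* Main.v *)
Require Import Defs.
From mathcomp Require Import all_boot all_order all_algebra reals.
From mathcomp Require Import classical_sets functions cardinality complex.
From mathcomp Require Import -(notations) mpoly.
Set Implicit Arguments.
Unset Strict Implicit.
Unset Printing Implicit Defensive.

Import Order.TTheory GRing.Theory Num.Theory.
Local Open Scope classical_set_scope.
Local Open Scope ring_scope.
Local Open Scope complex_scope.

(** A covariance matrix for the suspension with entry [a != 0] at the new
    vertex is determined by its first column [(a, b)] and by the Schur
    complement of [a].  The inverse of the Schur complement is the lower right
    block of the concentration matrix, and the non-edges of the suspension are
    those of [G], so the Schur complement maps the solutions for
    [[a, b^T], [b, C]] bijectively onto the solutions of [G] for
    [C - b b^T / a].  Scaling makes these equinumerous with the solutions for
    [a C - b b^T], which is polynomial in the data; genericity can therefore be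
    transported in both directions by substituting into polynomials. *)

(** * Block algebra of the Schur complement *)

Section SchurComplement.
Variable F : fieldType.

Definition schur_compl m (M : 'M[F]_(1 + m)) : 'M[F]_m :=
  drsubmx M - (M 0 0)^-1 *: (dlsubmx M *m (dlsubmx M)^T).

(** Inverse of [schur_compl] on symmetric matrices with first column [(a, b)]: the subtracted
    rank-one term is added back. *)
Definition schur_ext m (a : F) (b : 'cV[F]_m) (S : 'M[F]_m) : 'M[F]_(1 + m) :=
  block_mx a%:M b^T b (S + a^-1 *: (b *m b^T)).

Lemma schur_ext00 m (a : F) (b : 'cV[F]_m) S : schur_ext a b S 0 0 = a.
Proof. by rewrite -(lshift0 m 0) block_mxEul mxE. Qed.

Lemma schur_complK m (M : 'M[F]_(1 + m)) : symmetric_mx M ->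
  schur_ext (M 0 0) (dlsubmx M) (schur_compl M) = M.
Proof.
move=> symM; rewrite /schur_ext /schur_compl subrK trmx_dlsub symM.
rewrite -[RHS]submxK; congr block_mx.
by rewrite [RHS]mx11_scalar !mxE lshift0.
Qed.

Lemma schur_ext_inj m (a : F) (b : 'cV[F]_m) : injective (schur_ext a b).
Proof. by move=> S T /eq_block_mx[_ _ _ /addIr]. Qed.

Lemma schur_ext_sym m (a : F) (b : 'cV[F]_m) S :
  symmetric_mx (schur_ext a b S) <-> symmetric_mx S.
Proof.
rewrite /symmetric_mx /schur_ext tr_block_mx trmxK tr_scalar_mx linearD linearZ /=.
rewrite trmx_mul trmxK; split=> [/eq_block_mx[_ _ _ /addIr] //|-> //].
Qed.

(** Block elimination splits off a unipotent factor and leaves a block triangular matrix of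
    determinant [a * \det S]. *)
Lemma schur_ext_unit m (a : F) (b : 'cV[F]_m) S : a != 0 ->
  (schur_ext a b S \in unitmx) = (S \in unitmx).
Proof.
move=> a0; rewrite /schur_ext.
have -> : block_mx a%:M b^T b (S + a^-1 *: (b *m b^T)) =
    block_mx 1%:M 0 (a^-1 *: b) 1%:M *m block_mx a%:M b^T 0 S.
  rewrite mulmx_block !mul1mx !mul0mx !addr0 mul_mx_scalar scalerA.
  by rewrite divff // scale1r -scalemxAl addrC.
by rewrite !unitmxE det_mulmx det_lblock det_ublock !det1 !mul1r det_scalar
  expr1 unitrM unitfE a0.
Qed.

(** The upper right block of the product with the inverse [N] expresses [ursubmx N] through
    [drsubmx N]; substituted into the lower right block, it cancels the rank-one term and leaves
    [S *m drsubmx N = 1%:M]. *)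
Lemma drsubmx_inv_schur_ext m (a : F) (b : 'cV[F]_m) S : a != 0 ->
  S \in unitmx -> drsubmx (invmx (schur_ext a b S)) = invmx S.
Proof.
move=> a0 uS; set N := invmx _.
have := mulmxV (_ : schur_ext a b S \in unitmx).
rewrite schur_ext_unit // => /(_ uS); rewrite -/N -[N]submxK mulmx_block.
rewrite (scalar_mx_block 1 m 1) => /eq_block_mx[_ urE _ drE].
have SN : S *m drsubmx N = 1%:M.
  rewrite -drE mulmxDl -scalemxAl -mulmxA addrCA -[LHS]addr0; congr (_ + _).
  move: urE; rewrite mul_scalar_mx => /(canRL (addrK _)); rewrite sub0r => urE.
  rewrite -[ursubmx N]scale1r -(mulVf a0) -scalerA urE scalerN mulmxN.
  by rewrite -scalemxAr addNr.
by rewrite block_mxKdr -[LHS](mulKmx uS) SN mulmx1.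
Qed.

End SchurComplement.

Lemma map_schur_ext (F E : fieldType) (f : {rmorphism F -> E}) m (a : F)
    (b : 'cV[F]_m) S :
  map_mx f (schur_ext a b S) = schur_ext (f a) (map_mx f b) (map_mx f S).
Proof.
by rewrite /schur_ext map_block_mx map_scalar_mx map_mxD map_mxZ
  map_mxM fmorphV !map_trmx.
Qed.

(** * Polynomial functions on matrices *)

Section RegularFunctions.
Variable R : realType.

(** Working with functions up to pointwise equality avoids writing out multivariate polynomials. *)
Definition regular m (f : 'M[R]_m -> R) := exists p, mx_eval p =1 f.

Lemma regular_const m c : regular (fun _ : 'M[R]_m => c).
Proof. by exists (mpolyC _ c) => S; rewrite /mx_eval mevalC. Qed.

Lemma regular_coord m i j : regular (fun S : 'M[R]_m => S i j).
Proof.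
exists (mpolyX R (mnm1 (mxvec_index i j))) => S.
by rewrite /mx_eval mevalXU mxvecE.
Qed.

Lemma regularD m (f g : 'M[R]_m -> R) :
  regular f -> regular g -> regular (fun S => f S + g S).
Proof.
by move=> [p pf] [q qg]; exists (p + q) => S; rewrite -pf -qg; exact: mevalD.
Qed.

Lemma regularM m (f g : 'M[R]_m -> R) :
  regular f -> regular g -> regular (fun S => f S * g S).
Proof.
by move=> [p pf] [q qg]; exists (p * q) => S; rewrite -pf -qg; exact: mevalM.
Qed.

Lemma regular_comp m n (f : 'M[R]_n -> R) (h : 'M[R]_m -> 'M[R]_n) :
  regular f -> (forall i j, regular (fun S => h S i j)) ->
  regular (fun S => f (h S)).
Proof.
move=> [p pf] regh.
have /fin_all_exists[q qE] : forall k : 'I_(n * n),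
    exists q, forall S, mx_eval q S = mxvec (h S) 0 k.
  case/mxvec_indexP => i j; have [q qE] := regh i j.
  by exists q => S; rewrite mxvecE.
exists (comp_mpoly [tuple q k | k < n * n] p) => S.
rewrite -pf /mx_eval comp_mpoly_meval; apply: meval_eq => k.
by rewrite tnth_mktuple -qE.
Qed.

Lemma generic_symmetricP m (P : 'M[R]_m -> Prop) :
  generic_symmetric P <-> exists f, [/\ regular f,
    exists2 S, symmetric_mx S & f S != 0 &
    forall S, symmetric_mx S -> f S != 0 -> P S].
Proof.
split=> [[p [p0 hp]]|[f [[p pf] [S symS fS] hf]]].
  by exists (mx_eval p); split=> //; exists p.
exists p; split; first by exists S => //; rewrite pf.
by move=> T symT; rewrite pf; exact: hf.
Qed.

End RegularFunctions.

(** * Solution sets under suspension and scaling *)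

Section Solutions.
Variables (R : realType) (m : nat) (G : graph m).

Lemma suspension_edge_lift i j :
  suspension G (rshift 1 i) (rshift 1 j) = G i j.
Proof. by rewrite /= /suspension_edge !rshift1 !liftK. Qed.

Lemma suspension_edge0l j : suspension G ord0 j.
Proof. by rewrite /= /suspension_edge unlift_none. Qed.

Lemma suspension_edge0r i : suspension G i ord0.
Proof. by rewrite edge_sym suspension_edge0l. Qed.

(** The new vertex is adjacent to all, so the data prescribe the first row and column of a solution.
    In the lower right block, data and solution carry the same rank-one term, which cancels from the
    edge equations; all non-edges lie in this block, where the inverse is that of the Schur
    complement. *)
Lemma ML_solutions_suspension (a : R) (b : 'cV[R]_m) (S : 'M[R]_m) : a != 0 ->
  ML_solutions (suspension G) (schur_ext a b S : 'M_(m.+1)) =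
  schur_ext a%:C (map_mx (real_complex R) b) @` ML_solutions G S.
Proof.
move=> a0; set b' := map_mx _ b.
have a'0 : a%:C != 0 by rewrite fmorph_eq0.
have extE i j : (schur_ext a b S i j)%:C =
    schur_ext a%:C b' (map_mx (real_complex R) S) i j.
  by rewrite -map_schur_ext [RHS]mxE.
have drE (T : 'M_m) i j :
    schur_ext a%:C b' T (rshift 1 i) (rshift 1 j) =
    T i j + (a%:C^-1 *: (b' *m b'^T)) i j.
  by rewrite block_mxEdr mxE.
have invE (T : 'M_m) i j : T \in unitmx ->
    invmx (schur_ext a%:C b' T) (rshift 1 i) (rshift 1 j) = invmx T i j.
  by move=> uT; rewrite -(drsubmx_inv_schur_ext b' a'0 uT) !mxE.
apply/seteqP; split=> [M [symM uM edgeM nedgeM]|_ [T [symT uT edgeT nedgeT] <-]].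
- have M00 : M 0 0 = a%:C.
    by rewrite edgeM ?suspension_edge0l // extE schur_ext00.
  have Mdl : dlsubmx (M : 'M_(1 + m)) = b'.
    apply/matrixP=> i j; rewrite [j]ord1 !mxE lshift0.
    rewrite edgeM ?suspension_edge0r // -(lshift0 m 0).
    by rewrite [schur_ext _ _ _ _ _]block_mxEdl.
  have [T ME] : exists T, M = schur_ext a%:C b' T.
    exists (schur_compl (M : 'M_(1 + m))).
    by rewrite -M00 -Mdl schur_complK.
  move: symM uM edgeM nedgeM; rewrite {}ME => {M00 Mdl M}.
  move=> /schur_ext_sym symT; rewrite schur_ext_unit // => uT edgeT nedgeT.
  exists T => //; split=> // i j Gij.
  + have := edgeT (rshift 1 i) (rshift 1 j).
    rewrite suspension_edge_lift => /(_ Gij); rewrite extE !drE => /addIr.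
    by rewrite mxE.
  + have := nedgeT (rshift 1 i) (rshift 1 j).
    by rewrite suspension_edge_lift invE //; apply.
- split.
  + exact/schur_ext_sym.
  + by rewrite schur_ext_unit.
  (* Outside the lower right block both sides are the same entries of [a] and [b']. *)
  + move=> i j; rewrite extE.
    case: (split_ordP (i : 'I_(1 + m))) => i' ->;
      case: (split_ordP (j : 'I_(1 + m))) => j' ->; rewrite ?suspension_edge_lift.
    * by move=> _; rewrite [LHS]block_mxEul [RHS]block_mxEul.
    * by move=> _; rewrite [LHS]block_mxEur [RHS]block_mxEur.
    * by move=> _; rewrite [LHS]block_mxEdl [RHS]block_mxEdl.
    * by move=> Gij; rewrite [LHS]drE [RHS]drE edgeT // [in RHS]mxE.
  + move=> i j.
    case: (split_ordP (i : 'I_(1 + m))) => i' ->; last first.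
      case: (split_ordP (j : 'I_(1 + m))) => j' ->; last first.
        by rewrite suspension_edge_lift invE //; exact: nedgeT.
      by rewrite [j']ord1 lshift0 suspension_edge0r.
    by rewrite [i']ord1 lshift0 suspension_edge0l.
Qed.

Lemma card_ML_solutions_suspension (a : R) (b : 'cV[R]_m) (S : 'M[R]_m) :
  a != 0 ->
  (ML_solutions (suspension G) (schur_ext a b S : 'M_(m.+1)) #=
   ML_solutions G S)%card.
Proof.
move=> a0; rewrite ML_solutions_suspension //; apply: inj_card_eq.
by apply: in2W; exact: schur_ext_inj.
Qed.

Lemma ML_solutionsZ (c : R) (S : 'M[R]_m) T : c != 0 ->
  ML_solutions G S T -> ML_solutions G (c *: S) (c%:C *: T).
Proof.
move=> c0 [symT uT edgeT nedgeT].
have c'0 : c%:C != 0 by rewrite fmorph_eq0.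
have uc : c%:C \is a GRing.unit by rewrite unitfE.
split.
- by rewrite /symmetric_mx linearZ /= symT.
- by rewrite unitmxZ.
- by move=> i j Gij; rewrite !mxE edgeT // rmorphM.
- by move=> i j Gij; rewrite invmxZ ?unitmxZ // mxE nedgeT // mulr0.
Qed.

Lemma card_ML_solutionsZ (c : R) (S : 'M[R]_m) : c != 0 ->
  (ML_solutions G (c *: S) #= ML_solutions G S)%card.
Proof.
move=> c0.
have c'0 : c%:C != 0 by rewrite fmorph_eq0.
have -> : ML_solutions G (c *: S) = *:%R c%:C @` ML_solutions G S.
  apply/seteqP; split=> [T solT|_ [T solT <-]]; last exact: ML_solutionsZ.
  exists (c^-1%:C *: T).
    rewrite -[S]scale1r -(mulVf c0) -scalerA.
    by apply: ML_solutionsZ => //; rewrite invr_eq0.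
  by rewrite scalerA -rmorphM divff // scale1r.
by apply: inj_card_eq; apply: in2W; exact: scalerI.
Qed.

End Solutions.

(** * Transport of genericity *)

Lemma is_ML_degree_suspension (R : realType) m (G : graph m) d :
  is_ML_degree R G d -> is_ML_degree R (suspension G) d.
Proof.
move=> /generic_symmetricP[f [regf [S symS fS] hf]]; apply/generic_symmetricP.
(* The Schur complement with its denominator cleared, so that its entries are polynomial in [M]. *)
pose h (M : 'M[R]_(1 + m)) := M 0 0 *: drsubmx M - dlsubmx M *m (dlsubmx M)^T.
have hE (M : 'M[R]_(1 + m)) : M 0 0 != 0 -> h M = M 0 0 *: schur_compl M.
  by move=> M0; rewrite scalerBr scalerA divff // scale1r.
(* The factor [M 0 0] excludes a zero pivot. *)
exists (fun M : 'M_(m.+1) => M 0 0 * f (h M)); split.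
- apply: regularM; first exact: regular_coord.
  apply: regular_comp regf _ => i j.
  have [p pE] : regular (fun M : 'M[R]_(m.+1) =>
      M 0 0 * M (rshift 1 i) (rshift 1 j) +
      -1 * (M (rshift 1 i) 0 * M (rshift 1 j) 0)).
    by do ![exact: regular_const | exact: regular_coord
           | apply: regularD | apply: regularM].
  exists p => M; rewrite pE !mxE big_ord1 !mxE mulN1r.
  by rewrite !lshift0.
(* With pivot 1 and zero border, [h] returns [S] itself, where [f] does not vanish. *)
- exists (schur_ext 1 0 S); first exact/schur_ext_sym.
  rewrite schur_ext00 mul1r.
  suff -> : h (schur_ext 1 0 S) = S by [].
  by rewrite /h schur_ext00 /schur_ext block_mxKdl block_mxKdr mul0mx scaler0
    addr0 scale1r subr0.
- move=> M symM; rewrite mulf_eq0 negb_or => /andP[M0 fM].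
  have := card_ML_solutions_suspension G (dlsubmx (M : 'M_(1 + m)))
    (schur_compl (M : 'M_(1 + m))) M0.
  rewrite schur_complK // => cM.
  apply: card_eq_trans cM _.
  apply: card_eq_trans (hf (h M) _ fM); last first.
    rewrite /symmetric_mx /h linearB linearZ /= trmx_mul trmxK.
    by rewrite trmx_drsub symM.
  by rewrite hE // card_eq_sym card_ML_solutionsZ.
Qed.

Lemma is_ML_degree_unsuspension (R : realType) m (G : graph m) d :
  is_ML_degree R (suspension G) d -> is_ML_degree R G d.
Proof.
move=> /generic_symmetricP[f [regf [S symS fS] hf]].
(* Two nonempty Zariski open conditions on symmetric matrices have a common point. *)
have [M symM [fM M0]] : exists2 M : 'M[R]_(m.+1), symmetric_mx M &
    f M != 0 /\ M 0 0 != 0.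
  apply: generic_symmetric_and; apply/generic_symmetricP.
    by exists f; split=> //; exists S.
  exists (fun M : 'M[R]_(m.+1) => M 0 0); split=> //.
  - exact: regular_coord.
  - by exists 1%:M; [rewrite /symmetric_mx tr_scalar_mx | rewrite mxE oner_eq0].
apply/generic_symmetricP.
pose b := dlsubmx (M : 'M_(1 + m)).
(* Restrict [f] to the slice with the first column of [M]. As [M 0 0] is now a constant, its inverse
   keeps the entries polynomial in [C], and the Schur complement of [M] witnesses that the
   restriction is nonzero. *)
exists (fun C => f (schur_ext (M 0 0) b C)); split.
- apply: regular_comp regf _ => i j.
  case: (split_ordP (i : 'I_(1 + m))) => i' ->;
    case: (split_ordP (j : 'I_(1 + m))) => j' ->.
  + have [p pE] := regular_const m ((M 0 0)%:M i' j' : R).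
    by exists p => C; rewrite pE [RHS]block_mxEul.
  + have [p pE] := regular_const m (b^T i' j').
    by exists p => C; rewrite pE [RHS]block_mxEur.
  + have [p pE] := regular_const m (b i' j').
    by exists p => C; rewrite pE [RHS]block_mxEdl.
  + have [p pE] := regularD (regular_coord R i' j')
      (regular_const m (((M 0 0)^-1 *: (b *m b^T)) i' j')).
    by exists p => C; rewrite pE [RHS]block_mxEdr [RHS]mxE.
- exists (schur_compl (M : 'M_(1 + m))); last by rewrite schur_complK.
  by apply/(schur_ext_sym (M 0 0) b); rewrite schur_complK.
- move=> C /(schur_ext_sym (M 0 0) b) symC fC.
  apply: card_eq_trans (hf _ symC fC).
  by rewrite card_eq_sym card_ML_solutions_suspension.
Qed.

Theorem theorem4p11 (R : realType) (m : nat) (G : graph m) :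
  forall d : nat, is_ML_degree R G d <-> is_ML_degree R (suspension G) d.
Proof.
by split; [exact: is_ML_degree_suspension | exact: is_ML_degree_unsuspension].
Qed.
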